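(* Let $\alpha\in(0,1)$, let $m\ge 1$ be an integer, and let $C_\alpha\subset[0,1]$ be the central Cantor set with parameter $\alpha$. Put $$s_{\alpha,m}=\left\lceil \frac{1}{\left(\frac{1+\alpha}{2}\right)^{m-1}}\right\rceil,\qquad k_{\alpha,m}=\begin{cases}\left\lceil \dfrac{\frac{3\alpha-1}{2}}{\left(\frac{1+\alpha}{2}\right)^{m-1}\left(\frac{1-\alpha^2}{4}\right)}\right\rceil & \text{if }\alpha>1/3,\\[2mm] 0 & \text{if }\alpha\le 1/3,\end{cases}\qquad r_{\alpha,m}=2s_{\alpha,m}+2k_{\alpha,m},$$ and $$\Gamma_{\alpha,m}=\left\{\sum_{k=1}^{r_{\alpha,m}}c_k^m : c_k\in C_\alpha\right\}.$$ Let $$I=\left[\Big(\frac{r_{\alpha,m}}{2}-1\Big)+\Big(\frac{r_{\alpha,m}}{2}+1\Big)\left(\frac{1+\alpha}{2}\right)^m,\ \Big(\frac{r_{\alpha,m}}{2}+1\Big)+\Big(\frac{r_{\alpha,m}}{2}-1\Big)\left(\frac{1+\alpha}{2}\right)^m\right].$$ Then $I\subseteq\Gamma_{\alpha,m}$.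
   Context: For $\alpha\in(0,1)$ the central Cantor set is $C_\alpha=\bigcap_{l\ge 1}C_l$, where $C_0=[0,1]$ and, for $l\ge 1$, $C_l$ is obtained from $C_{l-1}$ (a disjoint union of $2^{l-1}$ closed intervals of equal length) by removing from each of these closed intervals the open interval with the same centre and with length $\alpha$ times the length of that closed interval. Thus $C_1=[0,\frac{1-\alpha}{2}]\cup[\frac{1+\alpha}{2},1]$, and $C_l$ is a union of $2^l$ closed intervals of length $\left(\frac{1-\alpha}{2}\right)^l$. *)

(* Defs.v *)
From HB Require Import structures.
From mathcomp Require Import all_boot all_order all_algebra.
From mathcomp Require Import archimedean.
From mathcomp Require Import all_classical all_reals.

Set Implicit Arguments.
Unset Strict Implicit.
Unset Printing Implicit Defensive.

Import Order.TTheory GRing.Theory Num.Theory.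

Local Open Scope classical_set_scope.
Local Open Scope ring_scope.

(* A pair J = (u, v) stands for the closed interval [u, v].  Removing from it
   the open interval with the same centre and of length alpha * (v - u) leaves
   the two closed intervals listed here. *)
Definition remove_middle (R : realType) (alpha : R) (J : R * R) : seq (R * R) :=
  let centre := (J.1 + J.2) / 2 in
  let gap := alpha * (J.2 - J.1) in
  [:: (J.1, centre - gap / 2); (centre + gap / 2, J.2)].

Fixpoint cantor_intervals (R : realType) (alpha : R) (l : nat) : seq (R * R) :=
  if l is l'.+1
  then flatten [seq remove_middle alpha J | J <- cantor_intervals alpha l']
  else [:: (0, 1)].

Definition cantor_level (R : realType) (alpha : R) (l : nat) : set R :=
  \bigcup_(J in [set` cantor_intervals alpha l]) `[J.1, J.2]%classic.

Definition central_cantor (R : realType) (alpha : R) : set R :=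
  \bigcap_(l in [set l : nat | (1 <= l)%N]) cantor_level alpha l.

(* The ceilings below are integers; the absolute value `|_|%N only casts them
   to nat, since their arguments are positive when 0 < alpha < 1.  The exponent
   m.-1 is the true predecessor for m >= 1. *)
Definition s_ (R : realType) (alpha : R) (m : nat) : nat :=
  `|Num.ceil (1 / ((1 + alpha) / 2) ^+ m.-1)|%N.

Definition k_ (R : realType) (alpha : R) (m : nat) : nat :=
  if alpha > 1 / 3
  then `|Num.ceil (((3 * alpha - 1) / 2) /
                   (((1 + alpha) / 2) ^+ m.-1 * ((1 - alpha ^+ 2) / 4)))|%N
  else 0%N.

Definition r_ (R : realType) (alpha : R) (m : nat) : nat :=
  (2 * s_ alpha m + 2 * k_ alpha m)%N.

Definition Gamma (R : realType) (alpha : R) (m : nat) : set R :=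
  [set x | exists c : 'I_(r_ alpha m) -> R,
      (forall k, central_cantor alpha (c k)) /\
      x = \sum_(k < r_ alpha m) c k ^+ m].

(* Main.v *)
Require Import Defs.
From HB Require Import structures.
From mathcomp Require Import all_boot all_order all_algebra.
From mathcomp Require Import archimedean.
From mathcomp Require Import all_classical all_reals.
From mathcomp Require Import ring lra.

Set Implicit Arguments.
Unset Strict Implicit.
Unset Printing Implicit Defensive.

Import Order.TTheory GRing.Theory Num.Theory.

Local Open Scope classical_set_scope.
Local Open Scope ring_scope.

(** Write [a = (1 + alpha) / 2], [b = (1 - alpha) / 2], [f t = t ^+ m] and
    [r = r_ alpha m], so that [a + b = 1].  Given [x] in the interval, one builds
    for every level [l >= 1] a choice of [r] intervals of level [l] contained in
    [[a, 1]], each nested in the one chosen at the level before, such that [x]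
    stays within [r * a ^+ m.-1 * m * b ^+ l / 2] of the sum of the midpoints of
    their [f]-images.  The left endpoints then converge to points of the Cantor
    set, and since the bound tends to [0], the [m]-th powers of these points add
    up to [x].

    At level one all intervals equal [[a, 1]] and [x] is within [1 - a ^+ m] of
    the sum of the midpoints; as [1 - a ^+ m <= m * b], the bound holds because
    [r * a ^+ m.-1 >= 2].

    To go one level down, replace the intervals one at a time by their left or
    right child, always choosing the child that moves the sum of midpoints
    towards [x].  For an interval of length [L] such a move has size between
    [m * a ^+ m * L / 2] and [m * a * L / 2], because the derivative of [f] on
    [[a, 1]] lies between [m * a ^+ m.-1] and [m].  By [greedy_balance] the new
    error is at most the new bound, provided that
    - the [r] moves together gain at least the difference of the two bounds:
      this is an equality, since [L - b * L = a * L];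
    - no move is larger than the new bound: this is
      [a <= r * a ^+ m.-1 * b].
    Both inequalities on [r] are in [r_bounds]; they are what the ceilings in
    the definition of [r] achieve, the second one through
    [(3 * alpha - 1) * (3 - alpha) >= 0] when [alpha > 1 / 3]. *)

(** * Increments of the power map *)

(** The lower bound [n * a ^+ n.-1 * (y - x)] on the increment of [t ^+ n],
    multiplied through by [a] to avoid the predecessor. *)
Lemma powB_ge (R : realFieldType) (a x y : R) (n : nat) :
  0 <= a -> a <= x -> x <= y ->
  n%:R * a ^+ n * (y - x) <= a * (y ^+ n - x ^+ n).
Proof.
move=> a0 ax xy; elim: n => [|n IHn]; first by rewrite !expr0; lra.
have x0 : 0 <= x := le_trans a0 ax.
have xyn : x ^+ n <= y ^+ n by rewrite lerXn2r ?nnegrE// (le_trans x0).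
have axn : a ^+ n <= x ^+ n by rewrite lerXn2r ?nnegrE.
rewrite !exprS -natr1.
have h1 := ler_wpM2l a0 IHn.
have h2 : 0 <= (y - a) * (y ^+ n - x ^+ n) by apply: mulr_ge0; lra.
have h3 : 0 <= (y - x) * (x ^+ n - a ^+ n) by apply: mulr_ge0; lra.
have h4 := mulr_ge0 a0 h2.
have h5 := mulr_ge0 a0 h3.
move: h1 h4 h5; move: (a ^+ n) (x ^+ n) (y ^+ n) (n%:R) => A X Y N.
lra.
Qed.

Lemma powB_le (R : realFieldType) (x y : R) (n : nat) :
  0 <= x -> x <= y -> y <= 1 -> y ^+ n - x ^+ n <= n%:R * (y - x).
Proof.
move=> x0 xy y1; elim: n => [|n IHn]; first by rewrite !expr0; lra.
have xyn : x ^+ n <= y ^+ n by rewrite lerXn2r ?nnegrE// (le_trans x0).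
have xn1 : x ^+ n <= 1 by rewrite exprn_ile1// (le_trans xy).
rewrite !exprS -natr1.
have h2 : 0 <= (1 - y) * (y ^+ n - x ^+ n) by apply: mulr_ge0; lra.
have h3 : 0 <= (y - x) * (1 - x ^+ n) by apply: mulr_ge0; lra.
move: IHn h2 h3; move: (x ^+ n) (y ^+ n) (n%:R) => X Y N.
lra.
Qed.

(** * Choice and limit principles *)

(** Greedy balancing: each of the [n] moves lowers the error by [e i] or raises
    it by [d i], always towards zero.  Moves of size at least [lo] bring an
    error of at most [T + n * lo] down to at most [T], and moves of size at most [T]
    cannot push it out again. *)
Lemma greedy_balance (R : realFieldType) (lo T : R) (n : nat)
    (d e : 'I_n -> R) (E : R) :
  0 <= lo -> (forall i, lo <= d i <= T) -> (forall i, lo <= e i <= T) ->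
  `|E| <= T + n%:R * lo ->
  exists b : 'I_n -> bool,
    `|E - \sum_i (if b i then e i else - d i)| <= T.
Proof.
move=> lo0; elim: n d e E => [|n IHn] d e E hd he hE.
  by exists (fun=> true); rewrite big_ord0 subr0; move: hE; rewrite mul0r addr0.
pose b0 := 0 <= E.
pose E' := E - (if b0 then e ord0 else - d ord0).
have hnlo : 0 <= n%:R * lo by rewrite mulr_ge0.
have hE' : `|E'| <= T + n%:R * lo.
  have := hd ord0; have := he ord0; move: hE; rewrite -natr1 mulrDl mul1r.
  rewrite /E' /b0 !ler_norml; case: (lerP 0 E) => E0; lra.
have [b hb] := IHn (fun i => d (lift ord0 i)) (fun i => e (lift ord0 i)) E'
  (fun i => hd _) (fun i => he _) hE'.
exists (fun i => if unlift ord0 i is Some j then b j else b0).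
rewrite big_ord_recl unlift_none opprD addrA.
by under eq_bigr do rewrite liftK.
Qed.

Lemma graded_dependent_choice (T : Type) (P : nat -> T -> Prop)
    (Q : nat -> T -> T -> Prop) (t0 : T) :
  P 0 t0 ->
  (forall l t, P l t -> exists t', P l.+1 t' /\ Q l t t') ->
  exists f : nat -> T,
    (forall l, P l (f l)) /\ (forall l, Q l (f l) (f l.+1)).
Proof.
move=> P0 step.
have step' (lt : nat * T) :
    exists t', P lt.1 lt.2 -> P lt.1.+1 t' /\ Q lt.1 lt.2 t'.
  have [/step [t' ht']|nP] := pselect (P lt.1 lt.2); first by exists t'.
  by exists lt.2 => /nP.
have [F hF] := choice step'.
pose f := nat_rect (fun=> T) t0 (fun l t => F (l, t)).
have Pf l : P l (f l) by elim: l => // l IHl; have [] := hF (l, f l) IHl.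
by exists f; split=> // l; have [] := hF (l, f l) (Pf l).
Qed.

Lemma nested_intervals_meet (R : realType) (u v : nat -> R) :
  (forall l, u l <= u l.+1) -> (forall l, v l.+1 <= v l) ->
  (forall l, u l <= v l) -> exists c, forall l, u l <= c <= v l.
Proof.
move=> uS vS uv.
have mu := homo_leq lexx le_trans uS.
have mv := homo_leq (r := fun x y => y <= x) lexx
  (fun y x z h1 h2 => le_trans h2 h1) vS.
have ub l : ubound (range u) (v l).
  move=> _ [k _ <-]; apply: (le_trans (mu _ _ (leq_maxl k l))).
  exact: le_trans (uv _) (mv _ _ (leq_maxr k l)).
exists (sup (range u)) => l; apply/andP; split.
  by apply: ub_le_sup; [exists (v 0%N); exact: ub | exists l].
by apply: ge_sup => //; exists (u 0%N); exists 0%N.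
Qed.

Lemma le_geometric_eq0 (R : realType) (b D y : R) :
  0 <= b -> b <= 1 / 2 -> (forall l, `|y| <= D * b ^+ l) -> y = 0.
Proof.
move=> b0 b2 h; apply/normr0_eq0/eqP; apply: contraT => y0.
have yp : 0 < `|y| by rewrite lt0r y0 normr_ge0.
pose l := Num.bound (D / `|y|).
have := upper_nthrootP (leqnn l); rewrite ltr_pdivrMr//.
have D0 : 0 <= D by have := h 0; rewrite expr0; lra.
have h1 : b ^+ l * 2 ^+ l <= 1 by rewrite -exprMn exprn_ile1//; lra.
have h2 : 0 < (2 : R) ^+ l by rewrite exprn_gt0.
have h3 := h l; rewrite -(ler_pM2r h2) in h3.
have := ler_wpM2l D0 h1; lra.
Qed.

(** * Refining a choice of Cantor intervals *)

Lemma cantor_intervals_children (R : realType) (alpha u L : R) (l : nat) :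
  (u, u + L) \in cantor_intervals alpha l ->
  (u, u + (1 - alpha) / 2 * L) \in cantor_intervals alpha l.+1 /\
  (u + (1 + alpha) / 2 * L, u + L) \in cantor_intervals alpha l.+1.
Proof.
move=> hu; have sub J : J \in remove_middle alpha (u, u + L) ->
    J \in cantor_intervals alpha l.+1.
  by move=> hJ; apply/flatten_mapP; exists (u, u + L).
by split; apply: sub; rewrite !inE /=; apply/orP; [left|right];
  apply/eqP; congr pair; field.
Qed.

(** The number [r] of summands is large enough for the greedy step (second
    bound) and for its start from the level-one intervals (first bound). *)
Lemma r_bounds (R : realType) (alpha : R) (m : nat) : 0 < alpha < 1 ->
  2 <= (r_ alpha m)%:R * ((1 + alpha) / 2) ^+ m.-1 /\
  (1 + alpha) / 2 <=
    (r_ alpha m)%:R * ((1 + alpha) / 2) ^+ m.-1 * ((1 - alpha) / 2).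
Proof.
move=> /andP[al0 al1]; set A := ((1 + alpha) / 2) ^+ m.-1.
have A0 : 0 < A by apply: exprn_gt0; lra.
have le_ceil (y : R) : y <= (`|Num.ceil y|%N)%:R.
  by rewrite natr_absz (le_trans (ceil_ge y))// ler_int ler_norm.
have hs : 1 <= (s_ alpha m)%:R * A by rewrite -ler_pdivrMr// le_ceil.
have hk : 0 <= (k_ alpha m)%:R * A by rewrite mulr_ge0// ltW.
have hk3 : 1 / 3 < alpha ->
    (3 * alpha - 1) / 2 <= (k_ alpha m)%:R * A * ((1 - alpha ^+ 2) / 4).
  move=> h3; rewrite /k_ h3 -mulrA -ler_pdivrMr ?le_ceil// mulr_gt0//.
  by rewrite divr_gt0// subr_gt0 expr_lt1// ltW.
have -> : (r_ alpha m)%:R * A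
    = 2 * ((s_ alpha m)%:R * A) + 2 * ((k_ alpha m)%:R * A).
  by rewrite /r_ natrD !natrM; ring.
move: hs hk hk3; move: (_%:R * A) ((k_ _ _)%:R * A) => S K hs hk hk3.
split; first by lra.
have [h3|h3] := ltP (1 / 3) alpha; last first.
  have : 0 <= (S + K - 1) * ((1 - alpha) / 2) by apply: mulr_ge0; lra.
  lra.
(* Multiplied by [(1 + alpha) / 2], the claim follows from
   [(3 * alpha - 1) * (3 - alpha) >= 0]. *)
have a0 : 0 < (1 + alpha) / 2 by lra.
rewrite -(ler_pM2l a0).
have h1 : 0 <= (3 * alpha - 1) * (3 - alpha) by apply: mulr_ge0; lra.
have h2 : 0 <= (S - 1) * ((1 + alpha) / 2 * ((1 - alpha) / 2)).
  by apply: mulr_ge0; [lra | apply: mulr_ge0; lra].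
have := hk3 h3; lra.
Qed.

(** A stage of the construction: [u i] is the left endpoint of a level-[l]
    interval, of length [((1 - alpha) / 2) ^+ l], lying to the right of the
    first gap, and [x] is close to the sum of the midpoints of the images of
    these [r] intervals under the [m]-th power map. *)
Definition approximates (R : realType) (alpha : R) (m r : nat) (x : R) (l : nat)
    (u : 'I_r -> R) : Prop :=
  let L := ((1 - alpha) / 2) ^+ l in
  [/\ forall i, (u i, u i + L) \in cantor_intervals alpha l,
      forall i, (1 + alpha) / 2 <= u i /\ u i + L <= 1 &
      `|x - \sum_i (u i ^+ m + (u i + L) ^+ m) / 2|
        <= r%:R * ((1 + alpha) / 2) ^+ m.-1 * m%:R * L / 2].

(** The left child keeps the left endpoint [u i]; the right child has left
    endpoint [u i + a * L], where [a = (1 + alpha) / 2] and [L] is the length. *)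
Lemma approximates_refine (R : realType) (alpha : R) (m r : nat) (x : R)
    (l : nat) (u : 'I_r -> R) :
  0 < alpha < 1 -> (0 < m)%N ->
  (1 + alpha) / 2 <= r%:R * ((1 + alpha) / 2) ^+ m.-1 * ((1 - alpha) / 2) ->
  approximates alpha m x l u ->
  exists u' : 'I_r -> R, approximates alpha m x l.+1 u' /\
    forall i, u i <= u' i /\
      u' i + ((1 - alpha) / 2) ^+ l.+1 <= u i + ((1 - alpha) / 2) ^+ l.
Proof.
move=> /andP[al0 al1] m0 hr; rewrite /approximates exprS.
set a := (1 + alpha) / 2 in hr *; set b := (1 - alpha) / 2 in hr *.
set L := b ^+ l.
have a0 : 0 < a by rewrite /a; lra.
have b0 : 0 < b by rewrite /b; lra.
have ab : a + b = 1 by rewrite /a /b; field.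
have L0 : 0 < L by apply: exprn_gt0.
have aL0 : 0 < a * L by apply: mulr_gt0.
have bL0 : 0 < b * L by apply: mulr_gt0.
have abL : a * L + b * L = L by rewrite -mulrDl ab mul1r.
set K := r%:R * a ^+ m.-1 in hr *.
case=> hC hI hE.
(* The midpoint of the image goes down by [d i] on passing to the left child,
   and up by [e i] on passing to the right child. *)
pose d i := ((u i + L) ^+ m - (u i + b * L) ^+ m) / 2.
pose e i := ((u i + a * L) ^+ m - u i ^+ m) / 2.
pose lo := m%:R * a ^+ m * L / 2.
pose T := K * m%:R * (b * L) / 2.
(* A move has size between [lo] and [m * a * L / 2 <= T]. *)
have move_size y : a <= y -> y + a * L <= 1 ->
    lo <= ((y + a * L) ^+ m - y ^+ m) / 2 <= T.
  move=> ay y1; have yaL : y <= y + a * L by lra.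
  have h1 := powB_ge m (ltW a0) ay yaL.
  have h2 := powB_le m (le_trans (ltW a0) ay) yaL y1.
  have h3 : m%:R * L * a <= m%:R * L * (K * b).
    by rewrite ler_wpM2l// mulr_ge0// ltW.
  rewrite addrAC subrr add0r in h1 h2.
  rewrite mulrCA ler_pM2l// in h1.
  rewrite /lo /T; move: h1 h2 h3; move: (_ ^+ m - _) => D; lra.
have hd i : lo <= d i <= T.
  have [ui1 ui2] := hI i.
  have -> : d i = ((u i + b * L + a * L) ^+ m - (u i + b * L) ^+ m) / 2.
    by rewrite /d -addrA [b * L + _]addrC abL.
  by apply: move_size; lra.
have he i : lo <= e i <= T by have [ui1 ui2] := hI i; apply: move_size; lra.
have lo0 : 0 <= lo.
  have am0 := ltW (exprn_gt0 m a0).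
  by rewrite divr_ge0// mulr_ge0 ?(ltW L0)// mulr_ge0.
have hE' : `|x - \sum_i (u i ^+ m + (u i + L) ^+ m) / 2| <= T + r%:R * lo.
  have -> : T + r%:R * lo = K * m%:R * L / 2; last exact: hE.
  by rewrite /T /lo /K -[in RHS]abL -[in LHS](prednK m0) exprS prednK//; field.
have [s hs] := greedy_balance lo0 hd he hE'.
exists (fun i => if s i then u i + a * L else u i); split; last first.
  by move=> i; case: (s i); lra.
split=> [i|i|].
- have [h1 h2] := cantor_intervals_children (hC i).
  by case: (s i) => //; rewrite -addrA abL.
- by have [] := hI i; case: (s i); lra.
- move: hs; rewrite /T; congr (`|_| <= _).
  rewrite -addrA -opprD -big_split /=; congr (x - _); apply: eq_bigr => i _.
  by case: (s i); rewrite /d /e -?addrA ?abL; field.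
Qed.

(** * Sums of powers of Cantor points *)

Theorem lemma2 (R : realType) (alpha : R) (m : nat)
    (halpha : 0 < alpha < 1) (hm : (1 <= m)%N) :
  `[((r_ alpha m)%:R / 2 - 1)
      + ((r_ alpha m)%:R / 2 + 1) * ((1 + alpha) / 2) ^+ m,
    ((r_ alpha m)%:R / 2 + 1)
      + ((r_ alpha m)%:R / 2 - 1) * ((1 + alpha) / 2) ^+ m]%classic
    `<=` Gamma alpha m.
Proof.
have /andP[al0 al1] := halpha.
have [hr2 hr] := r_bounds m halpha.
rewrite /Gamma; set r := r_ alpha m in hr2 hr *.
move=> x; rewrite /= in_itv /= => hx.
set a := (1 + alpha) / 2 in hr2 hr hx; set b := (1 - alpha) / 2 in hr.
have a0 : 0 < a by rewrite /a; lra.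
have b0 : 0 < b by rewrite /b; lra.
have ab : a + b = 1 by rewrite /a /b; field.
have start : approximates alpha m x 1 (fun _ : 'I_r => a).
  rewrite /approximates expr1 -/a -/b; split=> [i|i|].
  - have /cantor_intervals_children[_] :
        (0, 0 + 1 : R) \in cantor_intervals alpha 0.
      by rewrite add0r inE.
    by rewrite -/a mulr1 !add0r ab.
  - by rewrite ab.
  - rewrite ab expr1n big_const_ord iter_addr_0 -mulr_natl.
    have am : 1 - a ^+ m <= m%:R * b.
      have a1 : a <= 1 by lra.
      have <- : 1 - a = b by lra.
      by have := powB_le m (ltW a0) a1 (lexx 1); rewrite expr1n.
    have : 2 * (m%:R * b) <= r%:R * a ^+ m.-1 * (m%:R * b).
      by rewrite ler_wpM2r// mulr_ge0// ltW.
    rewrite ler_norml; move: hx am.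
    move: (r%:R * _ ^+ m.-1) => K; lra.
have [U [hU hUS]] := graded_dependent_choice
  (P := fun l (u : 'I_r -> R) => approximates alpha m x l.+1 u)
  (Q := fun l (u u' : 'I_r -> R) => forall i,
     u i <= u' i /\ u' i + b ^+ l.+2 <= u i + b ^+ l.+1)
  start (fun l u => @approximates_refine R alpha m r x l.+1 u halpha hm hr).
have /choice[c hc] (i : 'I_r) :
    exists c, forall l, U l i <= c <= U l i + b ^+ l.+1.
  apply: nested_intervals_meet => l; [| |by rewrite lerDl exprn_ge0// ltW].
    by have [] := hUS l i.
  by have [] := hUS l i.
exists c; split=> [i [//|l] _|].
  have [hC _ _] := hU l.
  exists (U l i, U l i + b ^+ l.+1); first exact: hC.
  by rewrite /= in_itv /= hc.
apply/eqP; rewrite -subr_eq0; apply/eqP.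
pose K := r%:R * a ^+ m.-1.
(* [x] and the sum of the [c i ^+ m] both lie near the sum of midpoints, within
   [K * m * L / 2] and [r * m * L / 2] respectively. *)
apply: (@le_geometric_eq0 _ b ((r%:R + K) * m%:R * b / 2));
  [exact: ltW|rewrite /b; lra|].
move=> l; have [_ hI hE] := hU l; set L := b ^+ l.+1 in hI hE.
rewrite -/a -/b -/L in hI hE.
have hS : `|\sum_i (U l i ^+ m + (U l i + L) ^+ m) / 2 - \sum_i c i ^+ m|
    <= r%:R * (m%:R * L / 2).
  rewrite -sumrB (le_trans (ler_norm_sum _ _ _))//.
  have -> : r%:R * (m%:R * L / 2) = \sum_(i < r) (m%:R * L / 2).
    by rewrite sumr_const card_ord mulr_natl.
  apply: ler_sum => i _; have [h1 h2] := hI i; have /andP[h3 h4] := hc i l.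
  have u0 : 0 <= U l i by lra.
  have c0 := le_trans u0 h3.
  have p1 : U l i ^+ m <= c i ^+ m by rewrite lerXn2r ?nnegrE.
  have p2 : c i ^+ m <= (U l i + L) ^+ m.
    by rewrite lerXn2r ?nnegrE//; exact: le_trans c0 h4.
  have := powB_le m u0 (le_trans h3 h4) h2; rewrite addrAC subrr add0r => p3.
  rewrite -/L in p3; rewrite ler_norml; lra.
have -> : (r%:R + K) * m%:R * b / 2 * b ^+ l
    = r%:R * a ^+ m.-1 * m%:R * L / 2 + r%:R * (m%:R * L / 2).
  by rewrite /K /L exprS; field.
have := lerD hE hS; apply: le_trans.
by rewrite (le_trans _ (ler_normD _ _))// addrA subrK.
Qed.
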